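(* Let $r>s\ge 1$ be fixed integers and let $p=p(n)=\omega\left(n^{-\frac{r-s}{2}}\right)$. Then almost surely $$\limsup_{n\to\infty}q^*(G_p(n,r,s))\le\frac{s}{r}.$$
   Context: For integers $n,r,s$, the Johnson graph $G(n,r,s)$ has as vertices all vectors $v\in\{0,1\}^n$ with exactly $r$ ones; two vertices are joined by an edge if and only if their inner product equals $s$. For $p\in[0,1]$, $G_p(n,r,s)$ is the random graph obtained from $G(n,r,s)$ by removing every edge with probability $1-p$ independently of all other edges. The random graphs of the sequence are regarded as defined on a common probability space. Modularity: for a graph $G$ with $e(G)$ edges and a partition $\mathcal{A}$ of its vertex set, $q(\mathcal{A})=\sum_{A\in\mathcal{A}}\frac{e(A)}{e(G)}-\sum_{A\in\mathcal{A}}\frac{(\sum_{v\in A}\deg(v))^2}{4e(G)^2}$, where $e(A)$ is the number of edges of $G$ with both endpoints in $A$. The modularity of $G$ is $q^*(G)=\max_{\mathcal{A}}q(\mathcal{A})$, over all partitions of the vertex set. $f=\omega(g)$ means $f(n)/g(n)\to\infty$ as $n\to\infty$. *)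

(* Defs.v *)
From HB Require Import structures.
From mathcomp Require Import all_boot all_order all_algebra.
From mathcomp Require Import all_classical all_reals all_analysis.

Set Implicit Arguments.
Unset Strict Implicit.
Unset Printing Implicit Defensive.

Import Order.TTheory GRing.Theory Num.Theory.
Import numFieldNormedType.Exports.

Local Open Scope ring_scope.

(* A finite simple graph on V is given by its edge set E : {set {set V}}, each
   edge being the two-element set of its endpoints. *)
Section Graph.
Variables (R : realType) (V : finType).
Implicit Types (E Q : {set {set V}}) (A : {set V}).

Definition edges_in E A : nat := #|[set e in E | e \subset A]%SET|.

Definition degree E (v : V) : nat := #|[set e in E | v \in e]%SET|.

(* If E is empty the divisions are by 0 and the value is 0. *)
Definition partition_modularity E Q : R :=
  \sum_(A in Q) (edges_in E A)%:R / #|E|%:R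
  - \sum_(A in Q) (\sum_(v in A) degree E v)%N%:R ^+ 2 / (4 * #|E|%:R ^+ 2).

Definition vertex_singletons : {set {set V}} := [set [set v] | v : V]%SET.

Lemma vertex_singletons_partition : finset.partition vertex_singletons [set: V]%SET.
Proof.
apply/and3P; split.
- apply/eqP/setP => v; rewrite inE; apply/bigcupP.
  by exists [set v]%SET; [exact/imsetP/ex_intro2 | rewrite inE].
- apply/finset.trivIsetP => _ _ /imsetP[u _ ->] /imsetP[v _ ->] uv.
  rewrite disjoints1 inE; apply: contra uv => /eqP -> //.
- by apply/imsetP => -[v _ /setP/(_ v)]; rewrite !inE eqxx.
Qed.

(* The seed of the maximum is the value at a partition, so this is exactly the
   maximum over all partitions. *)
Definition modularity E : R :=
  \big[Num.max/partition_modularity E vertex_singletons]_(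
      Q : {set {set V}} | finset.partition Q [set: V]%SET)
    partition_modularity E Q.

End Graph.

Definition johnson_vertex (n r : nat) : Type :=
  {v : {ffun 'I_n -> bool} | (\sum_(i < n) v i == r)%N}.

Definition inner_product (n r : nat) (u v : johnson_vertex n r) : nat :=
  (\sum_(i < n) val u i * val v i)%N.

Definition johnson_edges (n r s : nat) : {set {set johnson_vertex n r}} :=
  [set e : {set johnson_vertex n r} |
    [exists u : johnson_vertex n r, exists v : johnson_vertex n r,
      [&& u != v, inner_product u v == s & e == [set u; v]]]]%SET.

Section RandomGraph.
Context {d : measure_display} {T : measurableType d} {R : realType}.
Variable P : probability T R.

Definition mutually_independent (I : finType) (D : {set I}) (A : I -> set T) :
    Prop :=
  forall J : {set I}, J \subset D ->
    P (\bigcap_(i in [set` J]) A i)%classic = (\prod_(i in J) P (A i))%E.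

Definition independent_edge_removal (V : finType) (E : {set {set V}}) (p : R)
    (G : T -> {set {set V}}) : Prop :=
  let removed (e : {set V}) : set T := [set w | e \notin G w]%classic in
  [/\ forall w, G w \subset E,
      forall e, e \in E -> measurable (removed e),
      forall e, e \in E -> P (removed e) = (1 - p)%:E
    & mutually_independent E removed].

End RandomGraph.

Definition little_omega (R : realType) (f g : nat -> R) : Prop :=
  (f n / g n @[n --> \oo] --> +oo)%classic.

(* Main.v *)
Require Import Defs.
From mathcomp Require Import all_boot all_order all_algebra.
From mathcomp Require Import all_classical all_reals all_analysis.
From mathcomp Require Import ring lra zify.

(* Write N = C(n, r), k = r - s, and a_A = |A| / N for a block A of a partition Q.
   By y^2 >= 2 y a - a^2, applied to the relative volume y of each block, the
   modularity of a graph H at Q is at most the average over the edges e of H of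
     phi_Q(e) = sum_(A in Q) ([e c A] - |e n A| a_A + a_A^2),
   so one only has to control a linear functional of the random edges.
   On the full Johnson graph the average of phi_Q is at most s/r + o(1): if
   m_j(A) is the mean over the j-sets C of the squared proportion of A among the
   r-sets containing C, then m_j(A) is convex in j (a Hoeffding-type second
   difference is a mean of squares), hence r m_s <= s m_r + (r - s) m_0 with
   m_r = a_A and m_0 = a_A^2; and m_s counts, up to the factor
   C(n - s, k) / C(n - r, k) -> 1, the adjacent pairs inside A.
   Chernoff's bound for one partition, with a union bound over the at most N^N
   partitions, gives a failure probability at most (N exp(- c p C(n - r, k)))^N;
   as p C(n - r, k) exceeds a constant times sqrt n, this is at most 2^-n for
   large n, and the Borel-Cantelli lemma concludes. *)

Set Implicit Arguments.
Unset Strict Implicit.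
Unset Printing Implicit Defensive.

Import Order.TTheory GRing.Theory Num.Theory.

Local Open Scope ring_scope.

(** * Convexity of the mean squared superset density *)

(** Double counting of the pairs [(B, a)] with [a \in B]: a set [B] of size [k.+1] arises from each
    of its [k.+1] subsets [B :\ a]. *)
Lemma sum_superset_exchange (R : realFieldType) (T : finType) (k : nat)
    (F : {set T} -> R) :
  \sum_(C : {set T} | #|C| == k) \sum_(a | a \notin C) F (a |: C)%SET
  = k.+1%:R * \sum_(B : {set T} | #|B| == k.+1) F B.
Proof.
rewrite mulr_sumr.
transitivity (\sum_(B : {set T} | #|B| == k.+1) \sum_(a in B) F B); last first.
  by apply: eq_bigr => B /eqP cB; rewrite sumr_const cB mulr_natl.
rewrite !pair_big_dep /=.
rewrite (reindex_onto (fun p : {set T} * T => (p.1 :\ p.2, p.2)%SET)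
                      (fun p : {set T} * T => (p.2 |: p.1, p.2)%SET)) /=; last first.
  by move=> [C a] /= /andP[_ aC]; rewrite finset.setU1K.
apply: eq_big => [[B a]|[B a]] /=.
  rewrite !inE eqxx /= andbT xpair_eqE eqxx andbT.
  case: (boolP (a \in B)) => aB.
    by rewrite finset.setD1K// eqxx !andbT (cardsD1 a B) aB.
  rewrite andbF; apply/negP => /andP[_ /eqP E].
  by move: aB; rewrite -E setU11.
by move=> /andP[_ /eqP[->]].
Qed.

(* Expands [0 <= \sum_(a != b) (X a b - Y a - Y b + Z) ^ 2]. *)
Lemma second_difference_ge0 (R : realFieldType) (T : finType) (I : {set T})
    (X : T -> T -> R) (Y : T -> R) (Z : R) :
  (forall a b, X a b = X b a) ->
  (forall a, a \in I ->
     \sum_(b in I | b != a) X a b = (#|I|%:R - 1) * Y a) ->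
  \sum_(a in I) Y a = #|I|%:R * Z ->
  0 <= \sum_(a in I) \sum_(b in I | b != a) X a b ^+ 2
       - 2 * (#|I|%:R - 1) * (\sum_(a in I) Y a ^+ 2)
       + #|I|%:R * (#|I|%:R - 1) * Z ^+ 2.
Proof.
move=> Xsym XY YZ.
set m : R := #|I|%:R; set S2 := \sum_(a in I) Y a ^+ 2.
set SX := \sum_(a in I) _.
have card1 a : a \in I -> \sum_(b in I | b != a) (1 : R) = m - 1.
  move=> aI; rewrite /m.
  have -> : #|I|%:R = \sum_(b in I) (1 : R) by rewrite sumr_const.
  by rewrite (bigD1 a aI) /= [1 + _]addrC addrK.
have sumY a : a \in I -> \sum_(b in I | b != a) Y b = m * Z - Y a.
  by move=> aI; rewrite -YZ (bigD1 a aI) /= [Y a + _]addrC addrK.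
have sumYY a : a \in I -> \sum_(b in I | b != a) Y b ^+ 2 = S2 - Y a ^+ 2.
  by move=> aI; rewrite /S2 (bigD1 a aI) /= [Y a ^+ 2 + _]addrC addrK.
have XYb : \sum_(a in I) \sum_(b in I | b != a) X a b * Y b = (m - 1) * S2.
  rewrite (exchange_big_dep (mem I)) /=; last by move=> i j _ /andP[].
  rewrite mulr_sumr; apply: eq_bigr => b bI.
  under eq_bigr do rewrite Xsym.
  rewrite -mulr_suml (eq_bigl (fun a => (a \in I) && (a != b))).
    by rewrite XY// expr2 mulrA.
  by move=> a; rewrite bI eq_sym.
have sq : 0 <= \sum_(a in I) \sum_(b in I | b != a) (X a b - Y a - Y b + Z) ^+ 2.
  by apply: sumr_ge0 => a _; apply: sumr_ge0 => b _; rewrite sqr_ge0.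
(* The claimed expression is the sum of squares [sq] plus twice this variance, so it suffices that
   both are nonnegative. *)
have var : 0 <= \sum_(a in I) (Y a - Z) ^+ 2.
  by apply: sumr_ge0 => a _; rewrite sqr_ge0.
have varE : \sum_(a in I) (Y a - Z) ^+ 2 = S2 - m * Z ^+ 2.
  under eq_bigr do rewrite sqrrB.
  rewrite big_split sumrB /= sumrMnl -mulr_suml YZ sumr_const -/m -/S2.
  by rewrite -[Z ^+ 2 *+ _]mulr_natl -/m; ring.
(* [K] collects the terms independent of [a] left after summing over [b]. The existential makes it
   opaque, so that [big_split] treats it as one constant. *)
have [K KE] : exists K, K = S2 - (m + 1) * Z ^+ 2 by eexists.
have sqE : \sum_(a in I) \sum_(b in I | b != a) (X a b - Y a - Y b + Z) ^+ 2
   = SX - 2 * m * S2 + (m ^+ 2 + m) * Z ^+ 2.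
  transitivity (\sum_(a in I) (\sum_(b in I | b != a) X a b ^+ 2
      - 2 * (\sum_(b in I | b != a) X a b * Y b)
      + K - (m + 2) * Y a ^+ 2 + (2 * m + 2) * Z * Y a)).
    apply: eq_bigr => a aI.
    under eq_bigr => b _.
      have -> : (X a b - Y a - Y b + Z) ^+ 2 = X a b ^+ 2 - 2 * (X a b * Y b)
        + X a b * (2 * (Z - Y a)) + Y b ^+ 2 + Y b * (2 * (Y a - Z))
        + 1 * ((Z - Y a) ^+ 2) by ring.
      over.
    rewrite !big_split /= sumrN -!mulr_suml -mulr_sumr XY// sumY// card1// sumYY// KE.
    ring.
  rewrite !big_split /= !sumrN -!mulr_sumr XYb YZ sumr_const -/m -/S2 -/SX.
  by rewrite -[K *+ _]mulr_natl -/m KE; ring.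
have -> : SX - 2 * (m - 1) * S2 + m * (m - 1) * Z ^+ 2
  = (SX - 2 * m * S2 + (m ^+ 2 + m) * Z ^+ 2) + 2 * (S2 - m * Z ^+ 2) by ring.
by rewrite addr_ge0// ?mulr_ge0// -?sqE// -varE.
Qed.

(** By convexity the average slope from [0] to [j] is at most the next increment ([slope]), so
    average slopes are nondecreasing. The inequality is this monotonicity with denominators
    cleared. *)
Lemma convex_chord (R : realFieldType) (x : nat -> R) (r s : nat) :
  (forall j, (j.+2 <= r)%N -> x j.+1 - x j <= x j.+2 - x j.+1) ->
  (s <= r)%N -> r%:R * (x s - x 0%N) <= s%:R * (x r - x 0%N).
Proof.
move=> cvx sr.
have slope j : (j.+1 <= r)%N -> x j - x 0%N <= j%:R * (x j.+1 - x j).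
  elim: j => [|j IH] jr; first by rewrite subrr mul0r.
  have := IH (ltnW jr); have := cvx j jr.
  rewrite -natr1; have : (0 : R) <= j%:R by [].
  nra.
elim: r {cvx} slope sr => [|r IH] slope.
  by rewrite leqn0 => /eqP ->; rewrite subrr !mul0r.
rewrite leq_eqVlt => /predU1P[->//|]; rewrite ltnS => sr.
have := IH (fun j jr => slope j (leqW jr)) sr.
have := slope r (leqnn _).
case: r sr {IH slope} => [|r] sr.
  move: sr; rewrite leqn0 => /eqP ->; rewrite !mul0r subrr mulr0; lra.
move=> h1 h2.
have r0 : (0 : R) < r.+1%:R by rewrite ltr0n.
rewrite -(ler_pM2l r0) -natr1 mulrCA; set y : R := r.+1%:R in r0 h1 h2 *.
set u := x s - x 0%N in h2 *.
have s0 : (0 : R) <= s%:R by [].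
have e1 : s%:R * (x r.+1 - x 0%N) <= s%:R * (y * (x r.+2 - x r.+1)) by exact: ler_wpM2l.
have : (y + 1) * (y * u) <= (y + 1) * (s%:R * (x r.+1 - x 0%N)).
  by apply: ler_wpM2l => //; lra.
nra.
Qed.

Definition superset_count (T V : finType) (supp : V -> {set T}) (A : {set V})
  (C : {set T}) : nat := #|[set u in A | C \subset supp u]%SET|.

(** The binomial counts the [r]-sets containing [C]: when [supp] identifies [V] with the [r]-sets,
    this is the density of [A] in the link of [C]. *)
Definition superset_density (R : realFieldType) (T V : finType)
  (supp : V -> {set T}) (r : nat) (A : {set V}) (C : {set T}) : R :=
  (superset_count supp A C)%:R / 'C(#|T| - #|C|, r - #|C|)%:R.

Definition level_mean (R : realFieldType) (T : finType) (F : {set T} -> R)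
  (k : nat) : R := (\sum_(C : {set T} | #|C| == k) F C) / 'C(#|T|, k)%:R.

Section SupersetDensity.
Variables (R : realFieldType) (T V : finType) (supp : V -> {set T}) (r : nat).
Variable A : {set V}.
Variable card_supp : forall u, #|supp u| = r.
Variable r_le : (r <= #|T|)%N.

Let n := #|T|.
Let g : {set T} -> R := superset_density R supp r A.

Lemma sum_superset_count (C : {set T}) :
  (\sum_(a | a \notin C) superset_count supp A (a |: C)%SET
   = (r - #|C|) * superset_count supp A C)%N.
Proof.
rewrite /superset_count.
under eq_bigr => a _ do rewrite -sum1dep_card.
rewrite (exchange_big_dep (fun u => (u \in A) && (C \subset supp u))) /=; last first.
  move=> a u _; move=> /andP[-> aCu] /=.
  exact: fintype.subset_trans (finset.subsetU1 a C) aCu.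
rewrite -sum1dep_card big_distrr /=; apply: eq_bigr => u /andP[uA Cu].
rewrite muln1 -(card_supp u) -(cardsDS Cu) -sum1_card; apply: eq_bigl => a.
by rewrite inE uA /= finset.subUset finset.sub1set Cu andbT.
Qed.

(** Each [u] above [C] is counted once for every point of [supp u] outside [C]. After normalisation
    this is a martingale property, and it supplies the two averaging hypotheses of
    [second_difference_ge0]. *)
Lemma sum_superset_density (C : {set T}) : (#|C| < r)%N ->
  \sum_(a | a \notin C) g (a |: C)%SET = (n - #|C|)%:R * g C.
Proof.
move=> Cr; rewrite /g /superset_density.
have cU a : a \notin C -> #|(a |: C)%SET| = #|C|.+1 by move=> aC; rewrite cardsU1 aC.
transitivity ((\sum_(a | a \notin C) superset_count supp A (a |: C)%SET)%N%:R
  / 'C(n - #|C|.+1, r - #|C|.+1)%:R : R).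
  by rewrite natr_sum mulr_suml; apply: eq_bigr => a aC; rewrite cU.
rewrite sum_superset_count natrM -/n.
have b1 : 'C(n - #|C|.+1, r - #|C|.+1)%:R != 0 :> R.
  by rewrite pnatr_eq0 -lt0n bin_gt0 leq_sub2r.
have b2 : 'C(n - #|C|, r - #|C|)%:R != 0 :> R.
  by rewrite pnatr_eq0 -lt0n bin_gt0 leq_sub2r.
have : ((n - #|C|) * 'C(n - #|C|.+1, r - #|C|.+1)
        = (r - #|C|) * 'C(n - #|C|, r - #|C|))%N.
  by have := mul_bin_diag (n - #|C|) (r - #|C|.+1); rewrite -subnS -subSn// subSS.
move=> /(congr1 (fun k => k%:R : R)); rewrite !natrM => E.
apply: (mulIf b1); apply: (mulIf b2).
rewrite divfK// mulrAC -E.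
by field.
Qed.

(** [second_difference_ge0] is applied around each [j]-set [C], to the densities at [C] and at its
    one- and two-point extensions. Summing over [C] and exchanging turns these into the sums over
    three consecutive levels. *)
Lemma level_mean_convex (j : nat) : (j.+2 <= r)%N ->
  level_mean (fun C => g C ^+ 2) j.+1 - level_mean (fun C => g C ^+ 2) j
  <= level_mean (fun C => g C ^+ 2) j.+2 - level_mean (fun C => g C ^+ 2) j.+1.
Proof.
move=> jr.
have jn : (j.+2 <= n)%N by exact: leq_trans r_le.
pose x : R := (n - j)%:R.
have x1 : x - 1 = (n - j.+1)%:R.
  by rewrite /x subnS -subn1 [RHS]natrB ?mulr1n // subn_gt0 ltnW.
have local (C : {set T}) : #|C| == j ->
   0 <= \sum_(a | a \notin C) \sum_(b | b \notin (a |: C)%SET)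
          g (b |: (a |: C))%SET ^+ 2
       - 2 * (x - 1) * (\sum_(a | a \notin C) g (a |: C)%SET ^+ 2)
       + x * (x - 1) * g C ^+ 2.
  move=> /eqP cC.
  have cI : #|(~: C)%SET| = (n - j)%N by rewrite cardsCs finset.setCK cC.
  have inI a : (a \in (~: C)%SET) = (a \notin C) by rewrite inE.
  have inC a b : ((b \in ~: C) && (b != a))%SET = (b \notin (a |: C)%SET).
    by rewrite !inE negb_or andbC.
  under eq_bigl do rewrite -inI.
  under eq_bigr do under eq_bigl do rewrite -inC.
  under [X in _ - _ * X]eq_bigl do rewrite -inI.
  rewrite /x -cI; apply: second_difference_ge0.
  - by move=> a b; rewrite finset.setUCA.
  - move=> a; rewrite inI => aC; under eq_bigl do rewrite inC.
    by rewrite sum_superset_density ?cardsU1 ?aC ?cC// cI x1.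
  - under eq_bigl do rewrite inI.
    by rewrite sum_superset_density ?cI ?cC// ltnW.
have tot : 0 <= (j.+1 * j.+2)%:R * (\sum_(C : {set T} | #|C| == j.+2) g C ^+ 2)
   - 2 * (x - 1) * (j.+1%:R * \sum_(C : {set T} | #|C| == j.+1) g C ^+ 2)
   + x * (x - 1) * \sum_(C : {set T} | #|C| == j) g C ^+ 2.
  rewrite natrM -mulrA.
  rewrite -[j.+2%:R * _](sum_superset_exchange j.+1 (fun C => g C ^+ 2)).
  rewrite -(sum_superset_exchange j (fun D => \sum_(b | b \notin D) g (b |: D)%SET ^+ 2)).
  rewrite -(sum_superset_exchange j (fun C => g C ^+ 2)).
  rewrite !mulr_sumr -sumrB -big_split /=.
  exact: sumr_ge0.
rewrite -subr_ge0.
have b0 : 'C(n, j)%:R != 0 :> R by rewrite pnatr_eq0 -lt0n bin_gt0; lia.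
have b1 : 'C(n, j.+1)%:R != 0 :> R by rewrite pnatr_eq0 -lt0n bin_gt0; lia.
have b2 : 'C(n, j.+2)%:R != 0 :> R by rewrite pnatr_eq0 -lt0n bin_gt0; lia.
have E1 := congr1 (fun k => k%:R : R) (mul_bin_left n j).
have E2 := congr1 (fun k => k%:R : R) (mul_bin_left n j.+1).
rewrite !natrM -x1 -/x in E1 E2.
have b0' : (0 : R) < 'C(n, j)%:R by rewrite ltr0n bin_gt0; lia.
have x0 : 0 < x by rewrite ltr0n; lia.
have y0 : 0 < x - 1 by rewrite x1 ltr0n; lia.
rewrite /level_mean.
set t2 := \sum_(C : {set T} | #|C| == j.+2) _ in tot *.
set t1 := \sum_(C : {set T} | #|C| == j.+1) _ in tot *.
set t0 := \sum_(C : {set T} | #|C| == j) _ in tot *.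
(* The absorption identities [E1] and [E2] express every binomial through ['C(n, j)], so the second
   difference is the quantity in [tot] over a positive denominator. *)
have -> : t2 / 'C(n, j.+2)%:R - t1 / 'C(n, j.+1)%:R
    - (t1 / 'C(n, j.+1)%:R - t0 / 'C(n, j)%:R)
  = ((j.+1 * j.+2)%:R * t2 - 2 * (x - 1) * (j.+1%:R * t1) + x * (x - 1) * t0)
    / (x * (x - 1) * 'C(n, j)%:R).
  have j1 : j.+1%:R != 0 :> R by rewrite pnatr_eq0.
  have j2 : j.+2%:R != 0 :> R by rewrite pnatr_eq0.
  have -> : 'C(n, j.+2)%:R = (x - 1) * 'C(n, j.+1)%:R / j.+2%:R :> R.
    by rewrite -E2 mulrAC divff// mul1r.
  have -> : 'C(n, j.+1)%:R = x * 'C(n, j)%:R / j.+1%:R :> R.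
    by rewrite -E1 mulrAC divff// mul1r.
  rewrite natrM; field.
  by rewrite b0 !gt_eqF// ltr_wpDr.
by rewrite divr_ge0// !mulr_ge0// ltW.
Qed.

End SupersetDensity.

(* [superset_count] counts the [u \in A] containing [C]: at level [r] the mean
   of the squared density is the density of [A] (there [supp u] is [C]), at
   level [0] it is the square of that density, and convexity interpolates. *)
Lemma sum_superset_count_sqr_le (R : realFieldType) (T V : finType)
    (supp : V -> {set T}) (r s : nat) (A : {set V}) (a : R) :
  (forall u, #|supp u| = r) -> injective supp -> (r <= #|T|)%N -> (s <= r)%N ->
  a = #|A|%:R / 'C(#|T|, r)%:R ->
  r%:R * (\sum_(W : {set T} | #|W| == s) (superset_count supp A W)%:R ^+ 2)
  <= 'C(#|T|, s)%:R * 'C(#|T| - s, r - s)%:R ^+ 2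
     * (s%:R * a + (r - s)%:R * a ^+ 2).
Proof.
move=> card_supp supp_inj rT sr aE.
pose g := superset_density R supp r A.
pose m := level_mean (fun C => g C ^+ 2).
have chord := @convex_chord R m r s
  (fun j jr => level_mean_convex R A card_supp rT jr) sr.
have m0 : m 0%N = a ^+ 2.
  rewrite /m /level_mean bin0 divr1.
  rewrite (big_pred1 finset.set0); last by move=> C; rewrite /= cards_eq0.
  rewrite /g /superset_density cards0 !subn0 aE; congr ((_%:R / _) ^+ 2).
  by apply: eq_card => u; rewrite !inE finset.sub0set andbT.
have mr : m r = a.
  rewrite /m /level_mean aE; congr (_ / _).
  transitivity (\sum_(C : {set T} | #|C| == r) \sum_(u in A | supp u == C) (1 : R)).
    apply: eq_bigr => C /eqP cC.
    have countE : superset_count supp A C = #|[set u in A | supp u == C]%SET|.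
      apply: eq_card => u; rewrite !inE; congr (_ && _).
      by rewrite [RHS]eq_sym finset.eqEcard card_supp cC leqnn andbT.
    rewrite /g /superset_density cC subnn bin0 divr1 countE -natrX sumr_const.
    congr (_%:R).
    rewrite -[RHS]cardsE.
    (* Injectivity of [supp] makes the count 0 or 1, so squaring does not change it. *)
    have : (#|[set u in A | supp u == C]%SET| <= 1)%N.
      apply/card_le1_eqP => u v; rewrite !inE => /andP[_ /eqP uC] /andP[_ /eqP vC].
      by apply: supp_inj; rewrite uC.
    by case: #|_| => [|[|]].
  rewrite (exchange_big_dep (mem A)) /=; last by move=> C u _ /andP[].
  rewrite -sum1_card natr_sum; apply: eq_bigr => u uA.
  rewrite (big_pred1 (supp u))// => C /=; rewrite uA [RHS]eq_sym.
  by case: (supp u =P C) => [<-|_]; rewrite ?card_supp ?eqxx ?andbF.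
have mE : \sum_(W : {set T} | #|W| == s) (superset_count supp A W)%:R ^+ 2
  = 'C(#|T|, s)%:R * 'C(#|T| - s, r - s)%:R ^+ 2 * m s.
  rewrite /m /level_mean mulrC mulrA divfK; last first.
    by rewrite pnatr_eq0 -lt0n bin_gt0 (leq_trans sr).
  rewrite mulr_suml; apply: eq_bigr => W /eqP cW.
  rewrite /g /superset_density cW expr_div_n divfK// expf_neq0//.
  by rewrite pnatr_eq0 -lt0n bin_gt0 leq_sub2r.
rewrite mE mulrCA ler_wpM2l ?mulr_ge0 ?exprn_ge0//.
have : r%:R = s%:R + (r - s)%:R :> R by rewrite -natrD subnKC.
by move: chord; rewrite m0 mr => chord rE; rewrite -lerBlDl; nra.
Qed.

(** * Johnson graphs *)

Definition supp (n r : nat) (u : johnson_vertex n r) : {set 'I_n} :=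
  [set i | val u i]%SET.

Lemma card_supp (n r : nat) (u : johnson_vertex n r) : #|supp u| = r.
Proof.
rewrite -sum1dep_card big_mkcond -[RHS](eqP (valP u)).
by apply: eq_bigr => i _; case: (val u i).
Qed.

Lemma supp_inj (n r : nat) : injective (@supp n r).
Proof.
move=> u v /setP uv; apply/val_inj/ffunP => i.
by have := uv i; rewrite !inE.
Qed.

Lemma supp_surj (n r : nat) (B : {set 'I_n}) :
  #|B| = r -> exists u : johnson_vertex n r, supp u = B.
Proof.
move=> cB; pose f := [ffun i => i \in B].
have fr : (\sum_(i < n) f i == r)%N.
  rewrite -cB -sum1_card [X in _ == X]big_mkcond; apply/eqP/eq_bigr => i _.
  by rewrite ffunE; case: (i \in B).
by exists (exist _ f fr); apply/setP => i; rewrite !inE /= ffunE.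
Qed.

(** Together with the injectivity of [supp], this reduces counting vertices to counting [r]-subsets
    of ['I_n]. *)
Lemma imset_supp (n r : nat) (P : pred {set 'I_n}) :
  ((@supp n r) @: [set u | P (supp u)] = [set B : {set 'I_n} | (#|B| == r) && P B])%SET.
Proof.
apply/setP => B; rewrite inE; apply/imsetP/andP => [[u + ->]|[/eqP cB PB]].
  by rewrite inE card_supp eqxx.
by have [u uB] := supp_surj cB; exists u; rewrite ?inE uB.
Qed.

Lemma card_johnson_vertex (n r : nat) : #|{: johnson_vertex n r}| = 'C(n, r).
Proof.
rewrite -cardsT -(card_imset _ (@supp_inj n r)).
have -> : [set: johnson_vertex n r]%SET = [set u | predT (supp u)]%SET.
  by apply/setP => u; rewrite !inE.
rewrite imset_supp -[n in 'C(n, r)]card_ord -card_draws.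
by apply: eq_card => B; rewrite !inE andbT.
Qed.

Lemma inner_productE (n r : nat) (u v : johnson_vertex n r) :
  inner_product u v = #|(supp u :&: supp v)%SET|.
Proof.
rewrite -sum1_card [RHS]big_mkcond; apply: eq_bigr => i _.
by rewrite !inE; case: (val u i); case: (val v i).
Qed.

Lemma inner_product_sym (n r : nat) (u v : johnson_vertex n r) :
  inner_product u v = inner_product v u.
Proof. by rewrite !inner_productE finset.setIC. Qed.

Lemma inner_productvv (n r : nat) (u : johnson_vertex n r) :
  inner_product u u = r.
Proof. by rewrite inner_productE finset.setIid card_supp. Qed.

(** [B] is determined by [U :&: B] and [B :\: U], which range independently over the [s]-subsets of
    [U] and the [(r - s)]-subsets of its complement. *)
Lemma card_setI_draws (T : finType) (U : {set T}) (r s : nat) : (s <= r)%N ->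
  #|[set B : {set T} | (#|B| == r) && (#|U :&: B| == s)]%SET|
  = ('C(#|U|, s) * 'C(#|T| - #|U|, r - s))%N.
Proof.
move=> sr.
have -> : (#|T| - #|U| = #|(~: U)%SET|)%N by rewrite [RHS]cardsCs finset.setCK.
rewrite -!cards_draws -cardsX.
pose f (B : {set T}) := ((U :&: B)%SET, (B :\: U)%SET).
have finj : injective f.
  move=> B B' [E1 E2]; rewrite -(finset.setID B U) -(finset.setID B' U).
  by rewrite ![(_ :&: U)%SET]finset.setIC E1 E2.
rewrite -(card_imset _ finj); apply: eq_card => -[X Y]; rewrite !inE /=.
apply/imsetP/andP => [[B]|[/andP[XU /eqP cX] /andP[YU /eqP cY]]].
  rewrite inE => /andP[/eqP cB /eqP cUB] [-> ->].
  rewrite finset.subsetIl cUB eqxx; split=> //; apply/andP; split.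
    by rewrite finset.setDE finset.subsetIr.
  by rewrite cardsD finset.setIC cUB cB.
have YU0 : (U :&: Y = finset.set0)%SET.
  by apply/eqP; rewrite finset.setI_eq0 disjoint_sym finset.disjoints_subset.
have XY0 : (X :&: Y = finset.set0)%SET.
  by apply/eqP; rewrite -finset.subset0 -YU0 finset.setSI.
have UXY : (U :&: (X :|: Y) = X)%SET.
  by rewrite finset.setIUr YU0 finset.setU0; apply/finset.setIidPr.
exists (X :|: Y)%SET.
  by rewrite inE UXY cX eqxx cardsU XY0 cards0 cX cY subn0 subnKC// eqxx.
rewrite /f UXY finset.setDUl; congr (_, _).
have -> : (X :\: U = finset.set0)%SET by apply/eqP; rewrite finset.setD_eq0.
by rewrite finset.set0U finset.setDE; apply/esym/finset.setIidPl.
Qed.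

Lemma card_johnson_neighbours (n r s : nat) (v : johnson_vertex n r) :
  (s <= r)%N ->
  #|[set w | inner_product v w == s]%SET| = ('C(r, s) * 'C(n - r, r - s))%N.
Proof.
move=> sr; rewrite -(card_imset _ (@supp_inj n r)).
have := imset_supp r (fun B => #|(supp v :&: B)%SET| == s).
under eq_finset => w do rewrite -inner_productE.
by move=> ->; rewrite card_setI_draws// card_supp card_ord.
Qed.

Lemma johnson_edgeP (n r s : nat) (e : {set johnson_vertex n r}) :
  reflect (exists u v, [/\ u != v, inner_product u v = s & e = [set u; v]%SET])
    (e \in johnson_edges n r s).
Proof.
rewrite inE; apply: (iffP existsP) => [[u /existsP[v /and3P[uv /eqP h /eqP ->]]]|].
  by exists u, v.
move=> [u [v [uv h ->]]]; exists u; apply/existsP; exists v.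
by rewrite uv h !eqxx.
Qed.

Lemma in_johnson_edges (n r s : nat) (u v : johnson_vertex n r) : (s < r)%N ->
  ([set u; v]%SET \in johnson_edges n r s) = (inner_product u v == s).
Proof.
move=> sr; apply/johnson_edgeP/idP => [[x [y [xy h E]]]|uv]; last first.
  exists u, v; rewrite (eqP uv); split=> //.
  (* A vertex has inner product [r] with itself and [s < r], so there are no loops. *)
  by apply: contraTneq uv => ->; rewrite inner_productvv gtn_eqF.
have uv : u != v.
  by have := cards2 u v; rewrite E cards2 xy; case: (u != v).
have : u \in [set x; y]%SET by rewrite -E !inE eqxx.
have : v \in [set x; y]%SET by rewrite -E !inE eqxx orbT.
rewrite !inE => /orP[]/eqP vE /orP[]/eqP uE; move: uv; rewrite vE uE ?eqxx// => _.
  by rewrite inner_product_sym h.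
by rewrite h.
Qed.

Lemma card_johnson_edge (n r s : nat) (e : {set johnson_vertex n r}) :
  e \in johnson_edges n r s -> #|e| = 2%N.
Proof. by move=> /johnson_edgeP[u [v [uv _ ->]]]; rewrite cards2 uv. Qed.

(** The map from a neighbour [w] of [v] to the edge [[set v; w]] is a bijection onto the edges at
    [v]; it is injective because [s < r] forces [w != v]. *)
Lemma sum_edges_at (R : nmodType) (n r s : nat) (v : johnson_vertex n r)
    (F : {set johnson_vertex n r} -> R) : (s < r)%N ->
  \sum_(e in johnson_edges n r s | v \in e) F e
  = \sum_(w | inner_product v w == s) F [set v; w]%SET.
Proof.
move=> sr.
pose h w := [set v; w]%SET.
transitivity (\sum_(e in (h @: [set w | inner_product v w == s])%SET) F e).
  apply: eq_bigl => e; apply/andP/imsetP => [[/johnson_edgeP[x [y [xy xys ->]]]]|].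
    rewrite !inE /h => /orP[]/eqP ->.
      by exists y; rewrite // inE xys.
    by exists x; [rewrite inE inner_product_sym xys | rewrite finset.setUC].
  by move=> [w]; rewrite inE => /eqP vw ->; rewrite in_johnson_edges// vw eqxx !inE eqxx.
rewrite big_imset /=; first by apply: eq_bigl => w; rewrite inE.
move=> w w'; rewrite !inE => vw vw' /setP E.
have wv : w != v by apply: contraTneq vw => ->; rewrite inner_productvv gtn_eqF.
by have := E w; rewrite !inE eqxx orbT (negbTE wv) => /esym /eqP.
Qed.

Lemma sum_edges_double (R : nmodType) (n r s : nat)
    (F : {set johnson_vertex n r} -> R) : (s < r)%N ->
  (\sum_(e in johnson_edges n r s) F e) *+ 2
  = \sum_v \sum_(w | inner_product v w == s) F [set v; w]%SET.
Proof.
move=> sr; rewrite -sumrMnl.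
under [RHS]eq_bigr => v _ do rewrite -sum_edges_at//.
rewrite (exchange_big_dep (mem (johnson_edges n r s))) /=; last by move=> v e _ /andP[].
apply: eq_bigr => e eE; rewrite -(card_johnson_edge eE) -sumr_const.
by apply: eq_bigl => v; rewrite eE.
Qed.

Lemma degree_johnson (n r s : nat) (v : johnson_vertex n r) : (s < r)%N ->
  degree (johnson_edges n r s) v = ('C(r, s) * 'C(n - r, r - s))%N.
Proof.
move=> sr; rewrite -(card_johnson_neighbours v (ltnW sr)) /degree -!sum1dep_card.
exact: sum_edges_at (fun=> 1%N) sr.
Qed.

Lemma card_johnson_edges (n r s : nat) : (s < r)%N ->
  (2 * #|johnson_edges n r s| = 'C(n, r) * ('C(r, s) * 'C(n - r, r - s)))%N.
Proof.
move=> sr; have := @sum_edges_double nat n r s (fun=> 1%N) sr.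
under [RHS]eq_bigr => v _ do rewrite sum1dep_card card_johnson_neighbours ?(ltnW sr)//.
by rewrite sum1_card sum_nat_const card_johnson_vertex mul2n -addnn => <-; rewrite mulr2n.
Qed.

(** An ordered adjacent pair in [A] is counted by the square at [W = supp u :&: supp v]. The squares
    also count pairs whose supports share more than [W], hence only an inequality. *)
Lemma johnson_edges_in_le (n r s : nat) (A : {set johnson_vertex n r}) :
  (s < r)%N ->
  (edges_in (johnson_edges n r s) A * 2
   <= \sum_(W : {set 'I_n} | #|W| == s) superset_count (@supp n r) A W ^ 2)%N.
Proof.
move=> sr; have := sum_edges_double (fun e => (e \subset A : nat)) sr.
rewrite -big_mkcondr sum1dep_card mulr2n => E.
rewrite muln2 -addnn [X in (X <= _)%N]E.
pose c (W : {set 'I_n}) (u : johnson_vertex n r) := (u \in A) && (W \subset supp u).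
have countE W : superset_count (@supp n r) A W = (\sum_u c W u)%N.
  by rewrite /superset_count -sum1dep_card big_mkcond.
under [X in (_ <= X)%N]eq_bigr => W _.
  rewrite countE expnS expn1 big_distrl /=.
  under eq_bigr do rewrite big_distrr /=.
  over.
rewrite exchange_big; apply: leq_sum => u _ /=.
rewrite [X in (_ <= X)%N]exchange_big big_mkcond; apply: leq_sum => v _ /=.
case: eqP => // uv; rewrite finset.subUset !finset.sub1set.
case: (boolP (_ && _)) => // /andP[uA vA].
rewrite (bigD1 (supp u :&: supp v)%SET) /=; last by rewrite -inner_productE uv.
by rewrite /c uA vA finset.subsetIl finset.subsetIr.
Qed.

(** * Linearised modularity and its value on the Johnson graph *)

Definition block_density (R : realType) (V : finType) (A : {set V}) : R :=
  #|A|%:R / #|V|%:R.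

(* Linearises the modularity: summed over the edges of H, the score is
   obtained from [#|H| * q(Q)] on replacing [y ^+ 2] by [2 * y * a - a ^+ 2],
   where [y] is the relative volume of a block and [a] its density. *)
Definition edge_score (R : realType) (V : finType) (Q : {set {set V}})
    (e : {set V}) : R :=
  \sum_(A in Q) ((e \subset A)%:R - #|(e :&: A)%SET|%:R * block_density R A
                 + block_density R A ^+ 2).

Lemma sum_degree (V : finType) (H : {set {set V}}) (A : {set V}) :
  (\sum_(v in A) degree H v = \sum_(e in H) #|(e :&: A)%SET|)%N.
Proof.
under eq_bigr => v _ do rewrite /degree -sum1dep_card.
rewrite (exchange_big_dep (mem H)) /=; last by move=> v e _ /andP[].
apply: eq_bigr => e eH; rewrite -sum1_card; apply: eq_bigl => v.
by rewrite !inE eH andbC.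
Qed.

Lemma sum_edge_score (R : realType) (V : finType) (H Q : {set {set V}}) :
  \sum_(e in H) edge_score R Q e =
  \sum_(A in Q) ((edges_in H A)%:R
     - (\sum_(v in A) degree H v)%N%:R * block_density R A
     + #|H|%:R * block_density R A ^+ 2).
Proof.
rewrite exchange_big /=; apply: eq_bigr => A _.
rewrite big_split sumrB /= -mulr_suml sumr_const -[_ *+ #|H|]mulr_natl.
rewrite sum_degree natr_sum; congr (_ - _ + _).
rewrite /edges_in -sum1dep_card natr_sum big_mkcondr /=.
by apply: eq_bigr => e _; case: (e \subset A).
Qed.

Lemma partition_modularity_le_score (R : realType) (V : finType)
    (H Q : {set {set V}}) : H != finset.set0 ->
  partition_modularity R H Q <= (\sum_(e in H) edge_score R Q e) / #|H|%:R.
Proof.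
rewrite -cards_eq0 -lt0n => H0; have m0 : (0 : R) < #|H|%:R by rewrite ltr0n.
rewrite sum_edge_score /partition_modularity -sumrB mulr_suml.
apply: ler_sum => A _; set m : R := #|H|%:R in m0 *; set a := block_density R A.
set y : R := (\sum_(v in A) _)%N%:R; set x : R := (edges_in H A)%:R.
rewrite !mulrDl -addrA mulNr lerD2l -subr_ge0.
(* The gap for one block is exactly the square of its relative volume minus its density. *)
apply: le_trans (sqr_ge0 (y / (2 * m) - a)) _.
rewrite le_eqVlt; apply/orP; left; apply/eqP; field.
by rewrite !gt_eqF ?addr_gt0 ?exprn_gt0.
Qed.

Lemma sum_block_density (R : realType) (V : finType) (Q : {set {set V}}) :
  finset.partition Q [set: V]%SET -> (0 < #|V|)%N ->
  \sum_(A in Q) block_density R A = 1.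
Proof.
move=> /card_partition; rewrite cardsT => VE V0.
by rewrite -mulr_suml -natr_sum -VE divff// pnatr_eq0 -lt0n.
Qed.

Lemma block_density_ge0 (R : realType) (V : finType) (A : {set V}) :
  0 <= block_density R A.
Proof. by rewrite divr_ge0. Qed.

Lemma block_density_le1 (R : realType) (V : finType) (A : {set V}) :
  block_density R A <= 1.
Proof.
rewrite /block_density; have [->|V0] := posnP #|V|; first by rewrite invr0 mulr0.
by rewrite ler_pdivrMr ?ltr0n// mul1r ler_nat max_card.
Qed.

Lemma sum_block_density_sqr_le1 (R : realType) (V : finType) (Q : {set {set V}}) :
  finset.partition Q [set: V]%SET -> (0 < #|V|)%N ->
  \sum_(A in Q) block_density R A ^+ 2 <= 1.
Proof.
move=> QP V0; rewrite -(sum_block_density R QP V0); apply: ler_sum => A _.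
by rewrite expr2 ler_piMr ?block_density_ge0 ?block_density_le1.
Qed.

(** The three sums making up the score lie in [[0, 1]], [[0, 2]] and [[0, 1]], the middle one with a
    minus sign. This is the boundedness needed for the Chernoff estimate. *)
Lemma edge_score_bound (R : realType) (V : finType) (Q : {set {set V}})
    (e : {set V}) : finset.partition Q [set: V]%SET -> #|e| = 2%N ->
  `|edge_score R Q e| <= 2.
Proof.
move=> QP e2.
have V0 : (0 < #|V|)%N.
  by rewrite (leq_trans _ (max_card (mem e))) ?e2.
have trivQ := partition_trivIset QP.
have sumQ (F : V -> R) : \sum_(A in Q) \sum_(v in A) F v = \sum_v F v.
  rewrite -finset.big_trivIset//= (cover_partition QP).
  by apply: eq_bigl => v; rewrite inE.
have cap : \sum_(A in Q) #|(e :&: A)%SET|%:R = 2 :> R.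
  rewrite -e2 -sum1_card natr_sum [RHS]big_mkcond -sumQ; apply: eq_bigr => A _.
  rewrite -sum1_card natr_sum -big_mkcondr /=; apply: eq_bigl => v.
  by rewrite inE andbC.
have sub0 : 0 <= \sum_(A in Q) (e \subset A)%:R :> R by apply: sumr_ge0.
(* Only the block containing a fixed endpoint [v] of [e] can contain [e]. *)
have sub1 : \sum_(A in Q) (e \subset A)%:R <= 1 :> R.
  have /card_gt0P[v ve] : (0 < #|e|)%N by rewrite e2.
  have v1 : \sum_u (u == v)%:R = 1 :> R.
    by rewrite -natr_sum -big_mkcond sum1_card card1.
  rewrite -[leRHS]v1 -sumQ; apply: ler_sum => A _.
  case: (boolP (e \subset A)) => [/fintype.subsetP eA|_]; last exact: sumr_ge0.
  by rewrite (bigD1 v (eA v ve)) /= eqxx lerDl sumr_ge0.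
have sq0 : 0 <= \sum_(A in Q) block_density R A ^+ 2.
  by apply: sumr_ge0 => A _; rewrite sqr_ge0.
have sq1 := sum_block_density_sqr_le1 R QP V0.
have cap0 : 0 <= \sum_(A in Q) #|(e :&: A)%SET|%:R * block_density R A.
  by apply: sumr_ge0 => A _; rewrite mulr_ge0// block_density_ge0.
have cap2 : \sum_(A in Q) #|(e :&: A)%SET|%:R * block_density R A <= 2.
  rewrite -cap; apply: ler_sum => A _.
  by rewrite ler_piMr ?block_density_le1.
rewrite ler_norml /edge_score big_split sumrB /=; lra.
Qed.

(** Both sides count the pairs of an [s]-set inside an [r]-set; multiplied by the factorials of [s],
    [r - s] and [n - r], each becomes the factorial of [n]. *)
Lemma bin_subset_of_subset (n r s : nat) : (s <= r <= n)%N ->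
  ('C(n, r) * 'C(r, s) = 'C(n, s) * 'C(n - s, r - s))%N.
Proof.
move=> /andP[sr rn]; have sn := leq_trans sr rn.
have := bin_fact rn; have := bin_fact sr; have := bin_fact sn.
have := bin_fact (leq_sub2r s rn).
rewrite subnBA// subnK// => E1 E2 E3 E4.
apply/eqP; rewrite -(eqn_pmul2r (fact_gt0 s)) -(eqn_pmul2r (fact_gt0 (r - s))).
rewrite -(eqn_pmul2r (fact_gt0 (n - r))); apply/eqP.
transitivity (n`!).
  by rewrite -E4 -E3; ring.
by rewrite -E2 -E1; ring.
Qed.

(* [rho] bounds the proportion by which the pairs of vertices through a given
   [s]-set exceed those which meet exactly there. *)
Lemma johnson_score (R : realType) (n r s : nat)
    (Q : {set {set johnson_vertex n r}}) (rho : R) :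
  (s < r <= n)%N -> finset.partition Q [set: johnson_vertex n r]%SET ->
  1 <= rho -> 'C(n - s, r - s)%:R <= rho * 'C(n - r, r - s)%:R ->
  \sum_(e in johnson_edges n r s) edge_score R Q e
  <= #|johnson_edges n r s|%:R * (s%:R / r%:R + 2 * (rho - 1)).
Proof.
move=> /andP[sr rn] QP rho1 Crho.
have V0 : (0 < #|{: johnson_vertex n r}|)%N by rewrite card_johnson_vertex bin_gt0.
set m : R := #|_|%:R; pose t : R := s%:R / r%:R.
have r0 : (0 : R) < r%:R by rewrite ltr0n (leq_ltn_trans _ sr).
have m2 : 2 * m = 'C(n, s)%:R * 'C(n - s, r - s)%:R * 'C(n - r, r - s)%:R.
  by rewrite -!natrM card_johnson_edges// mulnA bin_subset_of_subset// (ltnW sr).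
have m0 : 0 <= m by [].
(* By regularity the volume of [A] is [2 * m * a], so the last two terms on the left add up to
   [- m * a ^+ 2]; the edge count is bounded through the convexity inequality. *)
have block (A : {set johnson_vertex n r}) : let a : R := block_density R A in
  (edges_in (johnson_edges n r s) A)%:R
     - (\sum_(v in A) degree (johnson_edges n r s) v)%N%:R * a + m * a ^+ 2
  <= m * (rho * t * a + (rho * (1 - t) - 1) * a ^+ 2).
  move=> a.
  have -> : (\sum_(v in A) degree (johnson_edges n r s) v)%N%:R = 2 * m * a.
    under eq_bigr => v _ do rewrite degree_johnson//.
    have -> : 2 * m = 'C(n, r)%:R * ('C(r, s) * 'C(n - r, r - s))%N%:R.
      by rewrite -!natrM card_johnson_edges.
    rewrite sum_nat_const natrM.
    rewrite /a /block_density card_johnson_vertex; field.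
    by rewrite pnatr_eq0 -lt0n bin_gt0.
  have ein : (edges_in (johnson_edges n r s) A)%:R <= m * rho * (t * a + (1 - t) * a ^+ 2).
    have a0 : 0 <= a by exact: block_density_ge0.
    have rT : (r <= #|'I_n|)%N by rewrite card_ord.
    have aE : a = #|A|%:R / 'C(#|'I_n|, r)%:R.
      by rewrite /a /block_density card_johnson_vertex card_ord.
    have := sum_superset_count_sqr_le (@card_supp n r) (@supp_inj n r) rT (ltnW sr) aE.
    rewrite card_ord natrB ?(ltnW sr)// => cnt.
    have := johnson_edges_in_le A sr; rewrite -(ler_nat R) natrM natr_sum.
    under eq_bigr do rewrite natrX.
    rewrite -(ler_pM2l r0) => /le_trans/(_ cnt) le1.
    rewrite -(ler_pM2l r0) -(ler_pM2l (ltr0n R 2)).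
    have tE : t * r%:R = s%:R by rewrite divfK// gt_eqF.
    set z : R := s%:R * a + (r%:R - s%:R) * a ^+ 2 in le1.
    have -> : 2 * (r%:R * (m * rho * (t * a + (1 - t) * a ^+ 2))) = rho * (2 * m) * z.
      by rewrite /z -tE; ring.
    rewrite mulrCA [2 * (edges_in _ _)%:R]mulrC; apply: le_trans le1 _.
    have z0 : 0 <= z.
      by rewrite addr_ge0 ?mulr_ge0 ?sqr_ge0// subr_ge0 ler_nat ltnW.
    apply: ler_wpM2r => //; rewrite m2.
    have C0 : (0 : R) <= 'C(n, s)%:R * 'C(n - s, r - s)%:R by rewrite mulr_ge0.
    by have := ler_wpM2l C0 Crho; lra.
  by apply: le_trans (lerD (lerB ein (lexx _)) (lexx _)) _; lra.
rewrite sum_edge_score -/m.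
apply: le_trans (ler_sum _ (fun A _ => block A)) _.
rewrite -mulr_sumr big_split /= -!mulr_sumr sum_block_density// mulr1.
apply: ler_wpM2l => //.
have := sum_block_density_sqr_le1 R QP V0.
set S := \sum_(A in Q) _ => S1.
have S0 : 0 <= S by apply: sumr_ge0 => A _; rewrite sqr_ge0.
have t0 : 0 <= t by rewrite divr_ge0// ltW.
have t1 : t <= 1 by rewrite ler_pdivrMr// mul1r ler_nat ltnW.
rewrite -/t.
(* The remaining left side is [t + (rho - 1) * t + (rho - 1) * S - rho * (t * S)]. *)
have : (rho - 1) * t <= rho - 1 by rewrite ler_piMr// subr_ge0.
have : (rho - 1) * S <= rho - 1 by rewrite ler_piMr// subr_ge0.
have : 0 <= rho * (t * S) by rewrite !mulr_ge0// (le_trans _ rho1).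
lra.
Qed.

(** * The law of the random graph *)

Section GraphLaw.
Context {d : measure_display} {T : measurableType d} {R : realType}.
Variables (P : probability T R) (V : finType) (E : {set {set V}}) (p : R).
Variable G : T -> {set {set V}}.
Variable G_random : independent_edge_removal P E p G.

(** Since [G w] lies in [E], the event is a finite intersection, over the edges of [E], of removal
    events and their complements. *)
Lemma measurable_graph_eq (H : {set {set V}}) :
  measurable [set w | G w = H]%classic.
Proof.
have [GE Gm _ _] := G_random.
have [HE|HE] := boolP (H \subset E); last first.
  rewrite (_ : [set w | _]%classic = classical_sets.set0)//.
  by apply/seteqP; split=> // w /= GwH; move: HE; rewrite -GwH GE.
pose S (e : {set V}) : set T := if e \in H then (~` [set w | e \notin G w])%classic
           else [set w | e \notin G w]%classic.
rewrite (_ : [set w | _]%classic = (\bigcap_(e in [set` E]) S e)%classic).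
  apply: fin_bigcap_measurable => // e eE; rewrite /S.
  by case: ifP => _; [apply: measurableC|]; exact: Gm.
apply/seteqP; split=> w /=.
  by move=> GwH e _; rewrite /S; case: ifPn => /= eH; rewrite GwH ?eH.
move=> Sw; apply/setP => e.
have [eE|eE] := boolP (e \in E); last first.
  rewrite (contraNF (fintype.subsetP (GE w) e) eE).
  by rewrite (contraNF (fintype.subsetP HE e) eE).
have := Sw e eE; rewrite /S; case: ifP => /= [eH /negP|eH /negbTE//].
by rewrite negbK.
Qed.

Definition graph_law (H : {set {set V}}) : R := fine (P [set w | G w = H]%classic).

Lemma graph_law_ge0 (H : {set {set V}}) : 0 <= graph_law H.
Proof. exact: fine_ge0. Qed.

Lemma measurable_graph_event (B : pred {set {set V}}) :
  measurable [set w | B (G w)]%classic.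
Proof.
rewrite (_ : [set w | _]%classic
   = (\bigcup_(H in [set` [set H | B H]%SET]) [set w | G w = H])%classic).
  by apply: fin_bigcup_measurable => // H _; exact: measurable_graph_eq.
apply/seteqP; split=> w /=; first by move=> Bw; exists (G w) => //=; rewrite inE.
by move=> [H /=]; rewrite inE => BH ->.
Qed.

Lemma graph_lawE (B : pred {set {set V}}) :
  P [set w | B (G w)]%classic = (\sum_(H | B H) graph_law H)%:E.
Proof.
rewrite (_ : [set w | _]%classic
   = (\bigcup_(H in [set` [set H | B H]%SET]) [set w | G w = H])%classic); last first.
  apply/seteqP; split=> w /=; first by move=> Bw; exists (G w) => //=; rewrite inE.
  by move=> [H /=]; rewrite inE => BH ->.
rewrite measure_fin_bigcup//=; last 2 first.
- by move=> H H' _ _ [w [/= <- <-]].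
- by move=> H _; exact: measurable_graph_eq.
have eB : [set` [set H | B H]%SET]%classic = [set` enum B]%classic.
  by apply/seteqP; split=> H /=; rewrite mem_enum inE.
rewrite eB -(fsbig_seq _ _ (enum_uniq B)) big_enum /= -sumEFin.
by apply: eq_bigr => H _; rewrite fineK// fin_num_measure//; exact: measurable_graph_eq.
Qed.

Lemma graph_law_avoid (J : {set {set V}}) : J \subset E ->
  \sum_(H : {set {set V}} | [disjoint J & H]) graph_law H = (1 - p) ^+ #|J|.
Proof.
move=> JE; have [_ _ Gp Gi] := G_random.
have := Gi J JE.
pose B (H : {set {set V}}) := [disjoint J & H].
rewrite (_ : (\bigcap_(i in _) _)%classic = [set w | B (G w)]%classic).
  rewrite (graph_lawE B).
  rewrite (eq_bigr (fun=> (1 - p)%:E)); last by move=> e /(fintype.subsetP JE)/Gp.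
  by rewrite prodEFin prodr_const => -[].
apply/seteqP; split=> w /=.
  by move=> h; apply/pred0P => e /=; apply/negP => /andP[eJ]; apply/negP/h.
by move=> /pred0P h e /= eJ; apply/negP => eG; have := h e; rewrite /= eJ eG.
Qed.

(** Independence is given for removals, so the product over [H] is rewritten through avoidance: a
    factor [(1 - x e) + x e] for [e] outside [H] and [0 + x e] inside. Expanding gives a sum of
    [c J] over [J] disjoint from [H], and [J] is avoided with probability [(1 - p) ^+ #|J|]. The
    condition off [E] kills the other [J]. *)
Lemma graph_law_mgf (x : {set V} -> R) : (forall e, e \notin E -> x e = 1) ->
  \sum_H graph_law H * \prod_(e in H) x e
  = \prod_(e in E) (x e + (1 - x e) * (1 - p)).
Proof.
move=> x1.
pose c (J : {set {set V}}) := \prod_e (if e \in J then 1 - x e else x e).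
have c0 (J : {set {set V}}) : ~~ (J \subset E) -> c J = 0.
  by move=> /subsetPn[e eJ eE]; rewrite /c (bigD1 e)//= eJ x1// subrr mul0r.
transitivity (\sum_(H : {set {set V}}) graph_law H *
  \sum_(J : {set {set V}} | [disjoint J & H]) c J).
  apply: eq_bigr => H _; congr (_ * _).
  transitivity (\prod_e ((if e \in H then 0 else 1 - x e)
                         + (if e \in H then x e else x e))).
    rewrite big_mkcond; apply: eq_bigr => e _.
    by case: ifP => _; rewrite ?add0r// subrK.
  rewrite bigA_distr [RHS]big_mkcond; apply: eq_bigr => J _.
  rewrite fun_if; case: ifPn => [JH|/pred0Pn[e /= /andP[eJ eH]]].
    apply: eq_bigr => e _; rewrite if_same; case: ifP => // eJ.
    by rewrite (disjointFr JH eJ).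
  by rewrite (bigD1 e)//= eJ eH mul0r.
transitivity (\sum_(H : {set {set V}})
  \sum_(J : {set {set V}} | [disjoint J & H]) graph_law H * c J).
  by apply: eq_bigr => H _; rewrite mulr_sumr.
rewrite (exchange_big_dep predT)//=.
transitivity (\sum_(J : {set {set V}})
  \prod_e (if e \in J then (1 - x e) * (1 - p) else x e)).
  apply: eq_bigr => J _; rewrite -mulr_suml.
  transitivity ((1 - p) ^+ #|J| * c J).
    have [JE|/c0->] := boolP (J \subset E); last by rewrite !mulr0.
    by rewrite graph_law_avoid.
  rewrite -prodr_const big_mkcond -big_split /=.
  by apply: eq_bigr => e _; case: ifP => _; rewrite ?mul1r// mulrC.
rewrite -bigA_distr [RHS]big_mkcond; apply: eq_bigr => e _.
by case: ifPn => [_|/x1->] /=; [rewrite addrC | rewrite subrr mul0r add0r].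
Qed.

End GraphLaw.

(** * Concentration for one partition and the union bound *)

Lemma expR_le_quadratic (R : realType) (y : R) : y <= 2^-1 ->
  expR y <= 1 + y + 2 * y ^+ 2.
Proof.
move=> y2.
(* It remains to compare with [(1 + y + 2 * y ^+ 2) * (1 - y) = 1 + y ^+ 2 * (1 - 2 * y)], which is
   at least 1. *)
have e1 : expR y * (1 - y) <= 1.
  rewrite -[X in _ <= X](expRxMexpNx_1 y) ler_pM2l ?expR_gt0//.
  exact: expR_ge1Dx.
have y1 : 0 < 1 - y by lra.
rewrite -(ler_pM2r y1); apply: le_trans e1 _.
have : 0 <= y ^+ 2 * (1 - 2 * y) by rewrite mulr_ge0 ?sqr_ge0//; lra.
lra.
Qed.

(** Exponential Markov inequality: the indicator of a positive sum is at most [expR] of [t] times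
    the sum, whose mean factorises by [graph_law_mgf]. *)
Lemma graph_law_chernoff (d : measure_display) (T : measurableType d)
    (R : realType) (P : probability T R) (V : finType) (E : {set {set V}}) (p : R)
    (G : T -> {set {set V}}) (psi : {set V} -> R) (delta : R) :
  independent_edge_removal P E p G -> 0 <= p <= 1 -> 0 <= delta <= 8 ->
  (forall e, e \in E -> `|psi e| <= 4) ->
  \sum_(e in E) psi e <= - (delta * #|E|%:R) ->
  \sum_(H : {set {set V}} | 0 < \sum_(e in H) psi e) graph_law P G H
  <= expR (- (p * #|E|%:R * delta ^+ 2 / 128)).
Proof.
move=> G_random /andP[p0 p1] /andP[d0 d8] psi4 psisum.
(* This [t] minimises [- t * delta + 32 * t ^+ 2], with value [- delta ^+ 2 / 128]; [delta <= 8]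
   keeps [t * psi e] below one half. *)
pose t := delta / 64.
pose x e := if e \in E then expR (t * psi e) else 1.
have law0 (H : {set {set V}}) : ~~ (H \subset E) -> graph_law P G H = 0.
  have [GE _ _ _] := G_random.
  move=> HE; rewrite /graph_law (_ : [set w | _]%classic = classical_sets.set0) ?measure0//.
  by apply/seteqP; split=> // w /= GwH; move: HE; rewrite -GwH GE.
apply: (@le_trans _ _ (\sum_(H : {set {set V}}) graph_law P G H * \prod_(e in H) x e)).
  rewrite big_mkcond; apply: ler_sum => H _.
  have [HE|/law0->] := boolP (H \subset E); last by rewrite mul0r; case: ifP.
  have -> : \prod_(e in H) x e = expR (t * \sum_(e in H) psi e).
    rewrite mulr_sumr expR_sum; apply: eq_bigr => e eH.
    by rewrite /x (fintype.subsetP HE).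
  case: ifPn => [h|_]; last by rewrite mulr_ge0 ?graph_law_ge0 ?expR_ge0.
  rewrite ler_peMr ?graph_law_ge0// -[leLHS]expR0 ler_expR.
  by rewrite mulr_ge0 ?divr_ge0// ltW.
rewrite (graph_law_mgf G_random); last by move=> e /negbTE eE; rewrite /x eE.
apply: (@le_trans _ _ (\prod_(e in E) expR (p * (t * psi e + 32 * t ^+ 2)))).
  apply: ler_prod => e eE; rewrite /x eE.
  have px : expR (t * psi e) + (1 - expR (t * psi e)) * (1 - p)
     = 1 + p * (expR (t * psi e) - 1) by ring.
  rewrite px; apply/andP; split.
    have := expR_ge0 (t * psi e); nra.
  apply: le_trans (expR_ge1Dx _); rewrite lerD2l; apply: ler_wpM2l => //.
  have := psi4 e eE; rewrite ler_norml => /andP[psil psiu].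
  have t0 : 0 <= t by rewrite divr_ge0.
  have t8 : t <= 8^-1 by rewrite /t; lra.
  have y2 : t * psi e <= 2^-1 by nra.
  have := expR_le_quadratic y2.
  have : (t * psi e) ^+ 2 <= 16 * t ^+ 2.
    by rewrite exprMn mulrC ler_wpM2r ?sqr_ge0//; nra.
  lra.
rewrite -expR_sum ler_expR -mulr_sumr big_split /= -mulr_sumr sumr_const.
rewrite -[_ *+ _]mulr_natl.
have : t * \sum_(e in E) psi e <= t * (- (delta * #|E|%:R)).
  by apply: ler_wpM2l => //; rewrite divr_ge0.
move=> /(lerD (lexx (#|E|%:R * (32 * t ^+ 2)))) /(ler_wpM2l p0).
rewrite addrC => /le_trans; apply.
by rewrite /t le_eqVlt; apply/orP; left; apply/eqP; field.
Qed.

(** A partition is recovered from the map sending each vertex to a chosen representative of its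
    block, as the partition into fibres. *)
Lemma card_partitions (V : finType) :
  (#|[set Q : {set {set V}} | finset.partition Q [set: V]%SET]%SET| <= #|V| ^ #|V|)%N.
Proof.
pose f (Q : {set {set V}}) : {ffun V -> V} :=
  [ffun v => odflt v [pick x in finset.pblock Q v]].
rewrite -card_ffun -(card_in_imset (f := f)); first exact: max_card.
move=> Q Q'; rewrite !inE => QP QP' fQQ'.
have key (S : {set {set V}}) : finset.partition S [set: V]%SET ->
    S = finset.preim_partition (f S) [set: V]%SET.
  move=> SP; rewrite -[LHS](finset.preim_partition_pblock SP).
  have fE u v : (f S u == f S v) = (finset.pblock S u == finset.pblock S v).
    have cov w : w \in finset.cover S by rewrite (cover_partition SP) inE.
    have tS := partition_trivIset SP.
    have fin w : f S w \in finset.pblock S w.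
      rewrite ffunE; case: pickP => [//|/(_ w)]; by rewrite finset.mem_pblock cov.
    apply/eqP/eqP => [E|E]; last first.
      rewrite !ffunE E; case: pickP => // /(_ u); by rewrite -E finset.mem_pblock cov.
    rewrite -(finset.def_pblock tS _ (fin u)) ?finset.pblock_mem// E.
    by rewrite (finset.def_pblock tS _ (fin v)) ?finset.pblock_mem.
  rewrite /finset.preim_partition /finset.equivalence_partition.
  apply: eq_imset => u; apply/setP => v; rewrite !inE /=.
  by rewrite fE.
by rewrite (key _ QP) (key _ QP') fQQ'.
Qed.

Lemma modularity_le (R : realType) (V : finType) (H : {set {set V}}) (c : R) :
  (forall Q, finset.partition Q [set: V]%SET -> partition_modularity R H Q <= c) ->
  modularity R H <= c.
Proof.
by move=> h; apply: bigmax_le => //; apply: h; exact: vertex_singletons_partition.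
Qed.

Lemma partition_modularity0 (R : realType) (V : finType) (Q : {set {set V}}) :
  partition_modularity R finset.set0 Q = 0.
Proof.
rewrite /partition_modularity cards0 !big1 ?subr0// => A _.
  by rewrite expr0n mulr0 invr0 mulr0.
by rewrite invr0 mulr0.
Qed.

Lemma johnson_modularity_tail (d : measure_display) (T : measurableType d)
    (R : realType) (P : probability T R) (n r s : nat) (p eps : R)
    (G : T -> {set {set johnson_vertex n r}}) :
  independent_edge_removal P (johnson_edges n r s) p G -> 0 <= p <= 1 ->
  (s < r <= n)%N -> 0 < eps <= 1 ->
  'C(n - s, r - s)%:R <= (1 + eps / 4) * 'C(n - r, r - s)%:R ->
  (P [set w | (s%:R / r%:R + eps < modularity R (G w))%R]%classic
   <= (('C(n, r)%:R
        * expR (- (eps ^+ 2 / 1024 * (p * 'C(n - r, r - s)%:R)))) ^+ 'C(n, r))%:E)%E.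
Proof.
move=> G_random p01 srn /andP[e0 e1] Crho; have /andP[sr rn] := srn.
set E := johnson_edges n r s in G_random *.
pose B (H : {set {set johnson_vertex n r}}) := s%:R / r%:R + eps < modularity R H.
pose psi (Q : {set {set johnson_vertex n r}}) e : R :=
  edge_score R Q e - (s%:R / r%:R + eps).
have t0 : 0 <= s%:R / r%:R :> R by rewrite divr_ge0.
have t1 : s%:R / r%:R <= 1 :> R.
  by rewrite ler_pdivrMr ?mul1r ?ler_nat ?(ltnW sr)// ltr0n (leq_ltn_trans _ sr).
(* Large modularity is witnessed by one partition, whose centred score is then positive. The empty
   graph is treated apart: its modularity is 0 by the convention on division by 0. *)
have BQ (H : {set {set johnson_vertex n r}}) : B H ->
    exists2 Q, finset.partition Q [set: johnson_vertex n r]%SET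
             & 0 < \sum_(e in H) psi Q e.
  move=> BH; apply: contrapT => noQ; move: BH; rewrite /B ltNge => /negP; apply.
  apply: modularity_le => Q QP.
  have [->|H0] := eqVneq H finset.set0.
    by rewrite partition_modularity0 addr_ge0// ltW.
  apply: le_trans (partition_modularity_le_score R Q H0) _.
  have m0 : (0 : R) < #|H|%:R by rewrite ltr0n lt0n cards_eq0.
  rewrite ler_pdivrMr// -subr_le0 leNgt; apply/negP => pos; apply: noQ.
  exists Q => //; rewrite /psi sumrB sumr_const -[_ *+ #|H|]mulr_natr; exact: pos.
rewrite (graph_lawE G_random B) lee_fin.
pose PQ := [set Q : {set {set johnson_vertex n r}}
           | finset.partition Q [set: johnson_vertex n r]%SET]%SET.
set m : R := #|E|%:R.
(* Chernoff's bound with [delta = eps / 2]: taking [rho = 1 + eps / 4] in [johnson_score] costs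
   [eps / 2] of the margin [eps]. *)
pose bnd := expR (- (p * m * (eps / 2) ^+ 2 / 128)).
apply: (@le_trans _ _ (\sum_(Q in PQ) bnd)).
  apply: (@le_trans _ _ (\sum_(Q in PQ)
     \sum_(H : {set {set johnson_vertex n r}} | 0 < \sum_(e in H) psi Q e)
       graph_law P G H)).
    rewrite (exchange_big_dep predT)//= big_mkcond; apply: ler_sum => H _.
    case: ifPn => [/BQ[Q QP pos]|_]; last first.
      by apply: sumr_ge0 => Q _; exact: graph_law_ge0.
    rewrite (bigD1 Q) /=; last by rewrite inE QP pos.
    by rewrite lerDl sumr_ge0// => Q' _; exact: graph_law_ge0.
  apply: ler_sum => Q; rewrite inE => QP.
  apply: (graph_law_chernoff G_random p01).
  - by apply/andP; split; lra.
  - move=> e eE; have := edge_score_bound R QP (card_johnson_edge eE).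
    by rewrite !ler_norml /psi => /andP[? ?]; apply/andP; split; lra.
  - rewrite /psi sumrB sumr_const -[_ *+ _]mulr_natr.
    have rho1 : 1 <= 1 + eps / 4 by lra.
    have := johnson_score srn QP rho1 Crho; rewrite -/E -/m => h.
    apply: le_trans (lerB h (lexx _)) _; rewrite le_eqVlt; apply/orP; left; apply/eqP.
    by move: (s%:R / r%:R) => t; field.
rewrite sumr_const -[_ *+ _]mulr_natr exprMn -expRM_natl mulrC.
apply: ler_pM => //; first exact: expR_ge0.
  by rewrite -natrX ler_nat -card_johnson_vertex card_partitions.
rewrite ler_expR mulrN lerN2.
(* Passing from [m] to [2 * m] turns the constant 512 into 1024; the factor ['C(r, s)], at least 1,
   is then dropped. *)
have mE : 2 * m = 'C(n, r)%:R * ('C(r, s)%:R * 'C(n - r, r - s)%:R).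
  by rewrite -!natrM card_johnson_edges.
have -> : p * m * (eps / 2) ^+ 2 / 128 = (2 * m) * (eps ^+ 2 / 1024 * p) by field.
have /andP[p0 _] := p01.
rewrite mE; set z := eps ^+ 2 / 1024.
have z0 : 0 <= z by apply: divr_ge0; [exact: sqr_ge0 | exact: ler0n].
clearbody z.
have -> : 'C(n, r)%:R * ('C(r, s)%:R * 'C(n - r, r - s)%:R) * (z * p)
  = 'C(n, r)%:R * ('C(r, s)%:R * (z * (p * 'C(n - r, r - s)%:R))) by ring.
rewrite ler_wpM2l// ler_peMl ?mulr_ge0//.
by rewrite -[1]/(1%:R) ler_nat bin_gt0 ltnW.
Qed.

(** * Asymptotics *)

Lemma ffact_ge (m k : nat) : ((m - k) ^ k <= m ^_ k)%N.
Proof.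
rewrite ffact_prod -[X in (_ ^ X)%N]card_ord -prod_nat_const.
by apply: leq_prod => i _; rewrite leq_sub2l// ltnW.
Qed.

Lemma ffact_le (m k : nat) : (m ^_ k <= m ^ k)%N.
Proof.
rewrite ffact_prod -[X in (_ ^ X)%N]card_ord -prod_nat_const.
by apply: leq_prod => i _; rewrite leq_subr.
Qed.

Lemma bin_leq_expn (n r : nat) : ('C(n, r) <= n ^ r)%N.
Proof.
by apply: leq_trans (ffact_le n r); rewrite -bin_ffact leq_pmulr ?fact_gt0.
Qed.

(** Induction with Pascal's rule. It makes the exponent ['C(n, r)] in the tail bound at least [n],
    hence the tails summable. *)
Lemma leq_bin (n r : nat) : (0 < r < n)%N -> (n <= 'C(n, r))%N.
Proof.
elim: n r => [|n IH] [|r]//= rn; rewrite binS.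
have [->|r0] := posnP r; first by rewrite bin1 bin0 addn1.
have [nr|nr] := ltnP r.+1 n; last first.
  have -> : r.+1 = n by lia.
  rewrite binn add1n ltnS; apply: IH; lia.
have := IH r.+1 nr; have : (0 < 'C(n, r))%N by rewrite bin_gt0; lia.
lia.
Qed.

Lemma bernoulli_inequality (R : realDomainType) (x : R) (k : nat) :
  0 <= x <= 1 -> 1 - k%:R * x <= (1 - x) ^+ k.
Proof.
move=> /andP[x0 x1]; elim: k => [|k IH]; first by rewrite mul0r subr0 expr0.
have y0 : 0 <= 1 - x by rewrite subr_ge0.
rewrite exprS; apply: le_trans (ler_wpM2l y0 IH).
have : 0 <= k%:R * x ^+ 2 by rewrite mulr_ge0 ?sqr_ge0.
rewrite -natr1; lra.
Qed.

(** With the factorial of [k] cleared, the left side is at most [n ^ k] and the binomial on the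
    right at least [(n - 2 * r) ^ k]; Bernoulli's inequality for [x = 2 * r / n] compares them, and
    [big] is the threshold it requires. *)
Lemma near_bin_ratio (R : realType) (r s : nat) (delta : R) : 0 < delta -> (s < r)%N ->
  \forall n \near \oo%classic,
    'C(n - s, r - s)%:R <= (1 + delta) * 'C(n - r, r - s)%:R :> R.
Proof.
move=> d0 sr; set k := (r - s)%N; have kpos : (0 < k)%N by rewrite subn_gt0.
near=> n.
have rn : (2 * r < n)%N by near: n; exact: nbhs_infty_gt.
have n0 : (0 : R) < n%:R by rewrite ltr0n; lia.
have big : 2 * r%:R * k%:R * (1 + delta) <= delta * n%:R.
  rewrite -ler_pdivrMl//; near: n; exact: nbhs_infty_ger.
have k0 : (0 : R) < k`!%:R by rewrite ltr0n fact_gt0.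
rewrite -(ler_pM2r k0) -mulrA -!natrM !bin_ffact.
apply: (@le_trans _ _ (n%:R ^+ k)).
  rewrite -natrX ler_nat (leq_trans (ffact_le _ _))// leq_exp2r ?leq_subr//.
apply: (@le_trans _ _ ((1 + delta) * (n%:R - 2 * r%:R) ^+ k)); last first.
  apply: ler_wpM2l; first by lra.
  have -> : n%:R - 2 * r%:R = (n - 2 * r)%:R :> R by rewrite natrB ?natrM// ltnW.
  rewrite -natrX ler_nat (leq_trans _ (ffact_ge _ _))// leq_exp2r//; lia.
pose x : R := 2 * r%:R / n%:R.
have -> : n%:R - 2 * r%:R = n%:R * (1 - x).
  by rewrite /x mulrBr mulr1 [n%:R * (_ / _)]mulrC divfK// gt_eqF.
rewrite exprMn mulrCA ler_peMr ?exprn_ge0//.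
have x01 : 0 <= x <= 1.
  rewrite divr_ge0 ?mulr_ge0//= ler_pdivrMr// mul1r -natrM ler_nat; lia.
have := bernoulli_inequality k x01.
move=> /(ler_wpM2l (_ : 0 <= 1 + delta)) h; apply: le_trans (h _); last by lra.
have xn : x * n%:R = 2 * r%:R by rewrite divfK// gt_eqF.
have : k%:R * x * (1 + delta) <= delta.
  by rewrite -(ler_pM2r n0) -[_ * n%:R]mulrAC -mulrA; move: big; rewrite -xn; lra.
lra.
Unshelve. all: by end_near.
Qed.

(** Put [y = sqrt n]. Eventually [p n] is at least [y ^- k], while the binomial is of order
    [y ^+ (2 * k)], so the exponent is at least [c' * y], and [expR (c' * y)] outgrows
    ['C(n, r) <= n ^ r]. *)
Lemma near_johnson_tail (R : realType) (r s : nat) (p : nat -> R) (c : R) :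
  (s < r)%N -> 0 < c ->
  little_omega p (fun n => n%:R `^ (- ((r%:R - s%:R) / 2))) ->
  \forall n \near \oo%classic,
    'C(n, r)%:R * expR (- (c * (p n * 'C(n - r, r - s)%:R))) <= 2^-1.
Proof.
move=> sr c0 p_omega; set k := (r - s)%N.
pose c' := c / (2 ^+ k * k`!%:R).
(* The Taylor term of degree [J.+1 = 2 * r.+1] turns [y] into [n ^+ r.+1]; the spare factor [n]
   absorbs [2 * K]. *)
pose J := (r + r).+1.
pose K := J.+1`!%:R / c' ^+ J.+1.
have f0 : (0 : R) < k`!%:R by rewrite ltr0n fact_gt0.
have c'0 : 0 < c' by rewrite divr_gt0// mulr_gt0// exprn_gt0.
near=> n.
have n2 : (2 * (r + k) < n)%N by near: n; exact: nbhs_infty_gt.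
have n0 : (0 : R) < n%:R by rewrite ltr0n; lia.
have pn : 1 <= p n / n%:R `^ (- ((r%:R - s%:R) / 2)).
  by near: n; move/cvgryPge : p_omega; apply.
have nK : 2 * K <= n%:R by near: n; exact: nbhs_infty_ger.
pose y : R := Num.sqrt n%:R.
have yn : y ^+ 2 = n%:R by rewrite sqr_sqrtr// ltW.
have y0 : 0 < y by rewrite sqrtr_gt0.
have y1 : 1 <= y by rewrite -sqrtr1 ler_wsqrtr// ler1n; lia.
have gE : n%:R `^ (- ((r%:R - s%:R) / 2)) = (y ^+ k)^-1.
  rewrite powRN; congr (_^-1).
  rewrite -natrB ?(ltnW sr)// mulrC powRrM powR12_sqrt ?(ltW n0)//.
  by rewrite powR_mulrn// ltW.
have yk0 : 0 < y ^+ k by rewrite exprn_gt0.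
have py : (y ^+ k)^-1 <= p n.
  by move: pn; rewrite gE invrK -ler_pdivrMr// div1r.
have Cn : (n%:R / 2) ^+ k <= 'C(n - r, k)%:R * k`!%:R :> R.
  rewrite -natrM bin_ffact; apply: (@le_trans _ _ ((n - r - k) ^ k)%N%:R); last first.
    by rewrite ler_nat ffact_ge.
  rewrite natrX lerXn2r ?nnegrE// ?divr_ge0// ler_pdivrMr// -natrM ler_nat; lia.
have xy : c' * y <= c * (p n * 'C(n - r, k)%:R).
  have e1 : y ^+ k / (2 ^+ k * k`!%:R) <= p n * 'C(n - r, k)%:R.
    apply: (@le_trans _ _ ((y ^+ k)^-1 * 'C(n - r, k)%:R)); last by rewrite ler_wpM2r.
    rewrite ler_pdivlMl// mulrA ler_pdivrMr ?mulr_gt0 ?exprn_gt0//.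
    move: Cn; rewrite -yn expr_div_n ler_pdivrMr ?exprn_gt0// -exprM mulnC exprM expr2.
    by rewrite -mulrA [k`!%:R * _]mulrC.
  rewrite /c' mulrAC -mulrA; apply: ler_wpM2l; first exact: ltW.
  apply: le_trans e1; apply: ler_wpM2r; first by rewrite invr_ge0 mulr_ge0.
  by rewrite -[leLHS]expr1 ler_weXn2l// subn_gt0.
have expy : c' ^+ J.+1 * n%:R ^+ r.+1 / J.+1`!%:R <= expR (c * (p n * 'C(n - r, k)%:R)).
  apply: (@le_trans _ _ (expR (c' * y))); last by rewrite ler_expR.
  have := @expR_ge1Dxn R (c' * y) J (mulr_ge0 (ltW c'0) (ltW y0)).
  rewrite exprMn; have -> : y ^+ J.+1 = n%:R ^+ r.+1.
    by rewrite -yn -exprM; congr (_ ^+ _); rewrite /J; lia.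
  lra.
rewrite expRN ler_pdivrMr ?expR_gt0//.
apply: (@le_trans _ _ (n%:R ^+ r)); first by rewrite -natrX ler_nat bin_leq_expn.
rewrite mulrC ler_pdivlMr//; apply: le_trans expy.
have J0 : (0 : R) < J.+1`!%:R by rewrite ltr0n fact_gt0.
rewrite ler_pdivlMr// [n%:R ^+ r.+1]exprS.
have -> : c' ^+ J.+1 * (n%:R * n%:R ^+ r) = n%:R ^+ r * (c' ^+ J.+1 * n%:R) by ring.
rewrite -mulrA; apply: ler_wpM2l; first by rewrite exprn_ge0.
by move: nK; rewrite /K mulrA ler_pdivrMr ?exprn_gt0// [n%:R * _]mulrC.
Unshelve. all: by end_near.
Qed.

(** * Almost sure bound by the Borel-Cantelli lemma *)

Lemma ae_near_modularity_le (R : realType) (d : measure_display)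
    (T : measurableType d) (P : probability T R) (r s : nat) (p : nat -> R)
    (G : forall n : nat, T -> {set {set johnson_vertex n r}}) (eps : R) :
  (s < r)%N -> (forall n, 0 <= p n <= 1) ->
  little_omega p (fun n => n%:R `^ (- ((r%:R - s%:R) / 2))) ->
  (forall n, independent_edge_removal P (johnson_edges n r s) (p n) (G n)) ->
  0 < eps <= 1 ->
  {ae P, forall w, \forall n \near \oo%classic,
     modularity R (G n w) <= s%:R / r%:R + eps}.
Proof.
move=> sr p01 p_omega G_random eps01; have /andP[e0 _] := eps01.
have e4 : 0 < eps / 4 by rewrite divr_gt0.
have c0 : 0 < eps ^+ 2 / 1024 by apply: divr_gt0; [exact: exprn_gt0 | rewrite ltr0n].
have [N1 _ hN1] := near_bin_ratio e4 sr.
have [N2 _ hN2] := near_johnson_tail sr c0 p_omega.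
(* The shift makes both asymptotic estimates and [r < n] hold at every index [k + N0]. *)
pose N0 := (N1 + N2 + r.+1)%N.
pose F k : set T :=
  [set w | (s%:R / r%:R + eps < modularity R (G (k + N0)%N w))%R]%classic.
have mF k : measurable (F k).
  exact: (measurable_graph_event (G_random (k + N0)%N)
    (fun H => s%:R / r%:R + eps < modularity R H)).
(* The bound is written as the summand of [epsilon_trick0], whose series is at most 1. *)
have PF k : (P (F k) <= (1 / (2 ^ k.+1)%N%:R)%:E)%E.
  set n := (k + N0)%N.
  have srn : (s < r <= n)%N by rewrite sr /n /N0; lia.
  have Crho : 'C(n - s, r - s)%:R <= (1 + eps / 4) * 'C(n - r, r - s)%:R :> R.
    by apply: hN1; rewrite /= /n /N0; lia.
  have tail : 'C(n, r)%:R
      * expR (- (eps ^+ 2 / 1024 * (p n * 'C(n - r, r - s)%:R))) <= 2^-1.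
    by apply: hN2; rewrite /= /n /N0; lia.
  apply: le_trans (johnson_modularity_tail (G_random n) (p01 n) srn eps01 Crho) _.
  rewrite lee_fin; set N := 'C(n, r).
  have nN : (k.+1 <= N)%N.
    apply: leq_trans (leq_bin (_ : (0 < r < n)%N)); rewrite /n /N0; lia.
  apply: (@le_trans _ _ (2^-1 ^+ N)).
    by rewrite lerXn2r// nnegrE ?mulr_ge0 ?expR_ge0.
  rewrite div1r natrX -exprVn; apply: ler_wiXn2l => //.
  by rewrite invf_le1 ?ltr0n// ler1n.
have null : P (lim_sup_set F) = 0%E.
  apply: lim_sup_set_cvg0 => //.
  apply: le_lt_trans (lee_nneseries _ _) _; [by []|by move=> k _; exact: PF|].
  apply: le_lt_trans (epsilon_trick0 _ _) _; first exact: ler01.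
  exact: ltry.
exists (lim_sup_set F); split=> //.
  apply: bigcapT_measurable => m; exact: bigcup_measurable.
move=> w /= bad; apply: contrapT => notlim; apply: bad.
move: notlim; rewrite /lim_sup_set => /existsNP[m /not_implyP[_ nm]].
exists (m + N0)%N => // n /= mn; rewrite leNgt; apply/negP => h; apply: nm.
exists (n - N0)%N; first by rewrite /=; lia.
by rewrite /F /= subnK//; lia.
Qed.

Lemma limn_esup_le (R : realType) (u : nat -> R) (c : R) :
  (\forall n \near \oo%classic, u n <= c) -> (limn_esup (fun n => (u n)%:E) <= c%:E)%E.
Proof.
move=> [N _ hN].
apply: (@le_trans _ _ (ereal_sup ((fun n => (u n)%:E) @` [set n | (N <= n)%N])%classic)).
  by apply: ereal_inf_lbound; exists [set n | (N <= n)%N]%classic => //; exists N.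
by apply: ge_ereal_sup => _ [n /= Nn <-]; rewrite lee_fin; exact: hN.
Qed.

Theorem theorem3p11 (R : realType) (d : measure_display) (T : measurableType d)
    (P : probability T R) (r s : nat) (p : nat -> R)
    (G : forall n : nat, T -> {set {set johnson_vertex n r}})
    (s_ge1 : (1 <= s)%N) (s_lt_r : (s < r)%N)
    (p01 : forall n, 0 <= p n <= 1)
    (p_omega : little_omega p (fun n => n%:R `^ (- ((r%:R - s%:R) / 2))))
    (G_random : forall n,
       independent_edge_removal P (johnson_edges n r s) (p n) (G n)) :
  {ae P, forall w,
     (limn_esup (fun n => (modularity R (G n w))%:E) <= (s%:R / r%:R)%:E)%E}.
Proof.
(* A countable family of margins lets the almost sure statements be intersected. *)
have eps01 k : 0 < (k.+1%:R^-1 : R) <= 1.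
  by rewrite invr_gt0 ltr0n /= invf_le1 ?ltr0n// ler1n.
have := ae_foralln (fun k =>
  ae_near_modularity_le s_lt_r p01 p_omega G_random (eps01 k)).
apply: filterS => w hw; apply/lee_addgt0Pr => e e0.
(* The index [Num.truncn e^-1] has a successor larger than [e^-1], so its margin is below [e]. *)
apply: le_trans (limn_esup_le (hw (Num.truncn e^-1))) _.
rewrite -EFinD lee_fin lerD2l.
rewrite -[leRHS]invrK lef_pV2 ?posrE ?invr_gt0 ?ltr0n//.
by rewrite ltW// truncnS_gt.
Qed.
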